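(* Let $G$ be a bridgeless cubic graph. Then $G$ has a 5-CDC in which one colour class is a 2-factor of $G$ if and only if $\tau(G)\le 4$.
   Context: An even subgraph is a subgraph in which every vertex has even degree (a disjoint union of cycles). A $k$-CDC of $G$ is a collection of $k$ even subgraphs (colour classes) of $G$ such that every edge of $G$ lies in exactly two of them. A 2-factor is a spanning 2-regular subgraph. The perfect matching index $\tau(G)$ of a bridgeless cubic graph is the smallest integer $k$ such that there exist perfect matchings $M_1,\dots,M_k$ of $G$ with $M_1\cup\dots\cup M_k=E(G)$. *)

(* Defs.v *)
From mathcomp Require Import all_boot.

Set Implicit Arguments.
Unset Strict Implicit.
Unset Printing Implicit Defensive.

(* Finite multigraphs: parallel edges and loops are allowed. The two ends of
   an edge are listed in an arbitrary order, which no definition below depends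
   on. *)
Record multigraph := Multigraph {
  vertex : finType;
  edge : finType;
  end1 : edge -> vertex;
  end2 : edge -> vertex
}.

Section Multigraph.

Variable G : multigraph.

(* A set A of edges stands for the spanning subgraph (V(G), A). *)
Implicit Types (A M : {set edge G}) (v : vertex G) (e : edge G).

(* A loop contributes 2 to the degree of its end. *)
Definition degree A v : nat :=
  #|[set e in A | end1 e == v]| + #|[set e in A | end2 e == v]|.

Definition cubic : Prop := forall v, degree [set: edge G] v = 3.

Definition adjacent A : rel (vertex G) := fun u v =>
  [exists e in A, ((end1 e == u) && (end2 e == v))
               || ((end1 e == v) && (end2 e == u))].

Definition num_components A : nat := n_comp (adjacent A) (vertex G).

Definition bridge e : Prop :=
  num_components [set: edge G] < num_components [set~ e].

Definition bridgeless : Prop := forall e, ~ bridge e.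

Definition even_subgraph A : Prop := forall v, ~~ odd (degree A v).

Definition two_factor A : Prop := forall v, degree A v = 2.

Definition perfect_matching M : Prop := forall v, degree M v = 1.

(* The classes are indexed, so some may be empty or coincide. *)
Definition is_CDC (k : nat) (C : 'I_k -> {set edge G}) : Prop :=
  (forall i, even_subgraph (C i)) /\
  (forall e, #|[set i | e \in C i]| = 2).

Definition perfect_matching_cover (k : nat) : Prop :=
  exists M : 'I_k -> {set edge G},
    (forall i, perfect_matching (M i)) /\ \bigcup_i M i = [set: edge G].

(* tau(G) = k. A relation, because a multigraph that is not bridgeless and
   cubic need not have any cover by perfect matchings. *)
Definition is_perfect_matching_index (k : nat) : Prop :=
  perfect_matching_cover k /\
  forall j, perfect_matching_cover j -> k <= j.

End Multigraph.

(* Main.v *)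
Require Import Defs.
From mathcomp Require Import all_boot.
From mathcomp Require Import zify.

Set Implicit Arguments.
Unset Strict Implicit.
Unset Printing Implicit Defensive.

(** Let D be a perfect matching. Taking the symmetric difference with D swaps
    even subgraphs with subgraphs all of whose degrees are odd. Applied to four
    subgraphs at once, it keeps the multiplicity with which they cover an edge
    outside D, and turns a multiplicity m on D into 4 - m.

    If a 5-CDC contains a 2-factor, let D be its complement. The other four
    classes cover D twice and the 2-factor once, hence so do their symmetric
    differences with D. The degrees of the latter at a vertex are four odd
    numbers with sum 1 * 2 + 2 * 1 = 4, so they all equal 1.

    Conversely, at every vertex four perfect matchings covering the graph use 4
    edges with multiplicity, so exactly one of the three edges is covered twice
    and the other two once. The doubly covered edges form a perfect matching D;
    its complement and the symmetric differences with D form the 5-CDC. *)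

Section Degrees.

Variable G : multigraph.
Implicit Types (A B D : {set edge G}) (v : vertex G) (e : edge G).

(** An entry of the incidence matrix, with value 2 at a loop, so that degrees become linear in the
    indicator of the edge set. *)
Definition incidence e v : nat := (end1 e == v) + (end2 e == v).

Lemma degreeE A v : degree A v = \sum_e (e \in A) * incidence e v.
Proof.
rewrite /degree -!sum1dep_card ![\sum_(_ | _) 1]big_mkcond -big_split /=.
by apply: eq_bigr => e _; rewrite /incidence; do 3 case: (_ \in _) || case: eqP.
Qed.

Lemma sum_incidence v : \sum_e incidence e v = degree [set: edge G] v.
Proof. by rewrite degreeE; apply: eq_bigr => e _; rewrite inE mul1n. Qed.

Lemma incidence_end1_gt0 e : 0 < incidence e (end1 e).
Proof. by rewrite /incidence eqxx. Qed.

Lemma degreeC A v : degree A v + degree (~: A) v = degree [set: edge G] v.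
Proof.
rewrite !degreeE -big_split /=; apply: eq_bigr => e _.
by rewrite !inE; case: (e \in A); rewrite !mul0n ?addn0.
Qed.

Definition symdiff A B : {set edge G} := [set e | (e \in A) (+) (e \in B)].

Lemma odd_degree_symdiff A B v :
  odd (degree (symdiff A B) v) = odd (degree A v) (+) odd (degree B v).
Proof.
rewrite !degreeE -oddD -big_split /= !(big_morph odd oddD (erefl (odd 0))).
apply: eq_bigr => e _; rewrite inE -mulnDl !oddM.
by case: (e \in A); case: (e \in B).
Qed.

Definition multiplicity k (C : 'I_k -> {set edge G}) e : nat :=
  \sum_i (e \in C i).

Lemma card_multiplicity k (C : 'I_k -> {set edge G}) e :
  #|[set i | e \in C i]| = multiplicity C e.
Proof.
by rewrite -sum1dep_card big_mkcond; apply: eq_bigr => i _; case: (_ \in _).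
Qed.

Lemma multiplicity_lift k (C : 'I_k.+1 -> {set edge G}) i e :
  multiplicity C e = (e \in C i) + multiplicity (C \o lift i) e.
Proof. by rewrite /multiplicity (bigD1_ord i). Qed.

Lemma sum_degree k (C : 'I_k -> {set edge G}) v :
  \sum_i degree (C i) v = \sum_e multiplicity C e * incidence e v.
Proof.
under eq_bigr do rewrite degreeE.
by rewrite exchange_big; apply: eq_bigr => e _; rewrite /multiplicity big_distrl.
Qed.

Lemma multiplicity_symdiff k (C : 'I_k -> {set edge G}) D e :
  multiplicity (fun i => symdiff (C i) D) e =
  if e \in D then k - multiplicity C e else multiplicity C e.
Proof.
case: ifP => eD; last first.
  by apply: eq_bigr => i _; rewrite inE eD addbF.
(* On [D] each of the [k] memberships is negated, so every index counts in exactly one of the two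
   multiplicities. *)
suff sum_k : multiplicity C e + multiplicity (fun i => symdiff (C i) D) e = k.
  by rewrite -[X in _ = X - _]sum_k addKn.
rewrite /multiplicity -big_split /=.
under eq_bigr => i _ do rewrite inE eD addbT addnC addn_negb.
by rewrite sum1_card card_ord.
Qed.

Lemma bigcup_multiplicity k (M : 'I_k -> {set edge G}) :
  \bigcup_i M i = [set: edge G] <-> forall e, 0 < multiplicity M e.
Proof.
split=> [cov e | mult_gt0].
  have : e \in \bigcup_i M i by rewrite cov inE.
  by case/bigcupP=> i _ eMi; rewrite /multiplicity (bigD1 i) //= eMi.
apply/setP => e; rewrite inE; apply/bigcupP.
have [i eMi | noM] := pickP (fun i => e \in M i); first by exists i.
by have := mult_gt0 e; rewrite /multiplicity big1 // => i _; rewrite noM.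
Qed.

End Degrees.

(** Odd numbers are at least 1, so the differences [d i - 1] lose nothing to truncation, and they
    sum to 0. *)
Lemma sum_odd_eq1 k (d : 'I_k -> nat) :
  (forall i, odd (d i)) -> \sum_i d i = k -> forall i, d i = 1.
Proof.
move=> d_odd sum_d i.
have d_gt0 j : 1 <= d j by case: (d j) (d_odd j).
have sum1 : \sum_(j < k) 1 = k by rewrite sum1_card card_ord.
have /eqP : \sum_j (d j - 1) = 0 by rewrite sumnB // sum_d sum1 subnn.
by rewrite sum_nat_eq0 => /forallP/(_ i)/= ; have := d_gt0 i; lia.
Qed.

Section Covers.

Variable G : multigraph.
Hypothesis Gcubic : cubic G.

Lemma two_factorC (A : {set edge G}) : two_factor A <-> perfect_matching (~: A).
Proof.
by split=> hA v; have := degreeC A v; rewrite Gcubic hA; lia.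
Qed.

Lemma CDC5_two_factor_cover (C : 'I_5 -> {set edge G}) i :
  is_CDC C -> two_factor (C i) -> perfect_matching_cover G 4.
Proof.
move=> [evenC coverC] facC; have matD := (two_factorC _).1 facC.
set D := ~: C i in matD.
have multC e : multiplicity (C \o lift i) e = (e \in D).+1.
  have := coverC e; rewrite card_multiplicity (multiplicity_lift C i) inE.
  by case: (e \in C i); lia.
pose M j := symdiff (C (lift i j)) D.
have multM e : multiplicity M e = (e \in D).+1.
  by rewrite multiplicity_symdiff multC; case: (e \in D).
exists M; split; last by apply/bigcup_multiplicity => e; rewrite multM.
move=> j v; apply: (sum_odd_eq1 (d := fun j => degree (M j) v)) => {j} [j|].
  by rewrite odd_degree_symdiff matD addbT evenC.
rewrite sum_degree.
(* The sum splits as the degree 3 of [v] in [G] plus its degree 1 in [D]. *)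
under eq_bigr => e _ do rewrite multM mulSn.
by rewrite big_split /= sum_incidence Gcubic -degreeE matD.
Qed.

Lemma cover_CDC5_two_factor :
  perfect_matching_cover G 4 ->
  exists C : 'I_5 -> {set edge G}, is_CDC C /\ exists i, two_factor (C i).
Proof.
move=> [M [matM /bigcup_multiplicity multM_gt0]].
(* This is 4 - 3; the subtraction is exact because every edge is covered. *)
have excess v : \sum_e (multiplicity M e - 1) * incidence e v = 1.
  have sumM : \sum_i degree (M i) v = 4.
    by under eq_bigr do rewrite matM; rewrite sum1_card card_ord.
  under eq_bigr do rewrite mulnBl mul1n.
  rewrite sumnB => [|e _]; last by rewrite leq_pmull.
  by rewrite -sum_degree sumM sum_incidence Gcubic.
pose D := [set e | multiplicity M e != 1].
(* A multiplicity above 2 would by itself push the excess at [end1 e] over 1. *)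
have multM e : multiplicity M e = (e \in D).+1.
  have := excess (end1 e); rewrite (bigD1 e) //= inE.
  have := incidence_end1_gt0 e; have := multM_gt0 e.
  by case: eqP => [-> // | ]; nia.
have matD : perfect_matching D.
  move=> v; rewrite degreeE -(excess v).
  by apply: eq_bigr => e _; rewrite multM subn1.
have facD : two_factor (~: D) by apply/two_factorC; rewrite setCK.
pose C (i : 'I_5) :=
  if unlift ord0 i is Some j then symdiff (M j) D else ~: D.
have C0 : C ord0 = ~: D by rewrite /C unlift_none.
exists C; split; last by exists ord0; rewrite C0.
split=> [i v | e].
  rewrite /C; case: unlift => [j|]; last by rewrite facD.
  by rewrite odd_degree_symdiff matM matD.
rewrite card_multiplicity (multiplicity_lift C ord0) C0.
have -> : multiplicity (C \o lift ord0) e =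
          multiplicity (fun j => symdiff (M j) D) e.
  by apply: eq_bigr => j _; rewrite /C /= liftK.
by rewrite multiplicity_symdiff multM inE; case: (e \in D).
Qed.

Lemma perfect_matching_cover_widen j k :
  j <= k -> perfect_matching_cover G j -> perfect_matching_cover G k.
Proof.
(* With [j = 0] there is no matching to repeat, but then [G] has no edges and, being cubic, no
   vertices. *)
case: j => [|j] le_jk [M [matM covM]].
  have noE (e : edge G) : False.
    by have := in_setT e; rewrite -covM big_ord0 inE.
  have noV (v : vertex G) : False.
    by have := Gcubic v; rewrite degreeE big1 // => e; case: (noE e).
  exists (fun=> set0); split=> [i v | ]; first by case: (noV v).
  by apply/setP => e; case: (noE e).
(* [inord] sends indices out of range to 0, so the family is padded with copies of its first
   matching. *)
exists (fun i => M (inord i)); split=> [i | ]; first exact: matM.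
apply/setP => e; rewrite inE; apply/bigcupP.
have : e \in \bigcup_i M i by rewrite covM inE.
case/bigcupP=> i _ eMi; exists (widen_ord le_jk i) => //=.
by rewrite inord_val.
Qed.

End Covers.

(** Finitely supported families make the existence of a cover decidable, so that a least [k] can be
    extracted by [ex_minnP]. *)
Definition perfect_matching_coverb (G : multigraph) (k : nat) : bool :=
  [exists M : {ffun 'I_k -> {set edge G}},
    [forall i, forall v, degree (M i) v == 1]
    && (\bigcup_i M i == [set: edge G])].

Lemma perfect_matching_coverP (G : multigraph) (k : nat) :
  reflect (perfect_matching_cover G k) (perfect_matching_coverb G k).
Proof.
apply: (iffP existsP) => [[M /andP[/forallP matM /eqP covM]] | [M [matM covM]]].
  by exists M; split=> // i v; apply/eqP; have /forallP := matM i; apply.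
exists (finfun M); apply/andP; split.
  by apply/forallP => i; apply/forallP => v; rewrite ffunE matM.
by rewrite -covM; apply/eqP/eq_bigr => i _; rewrite ffunE.
Qed.

Lemma perfect_matching_index_leP (G : multigraph) (n : nat) : cubic G ->
  (exists k, is_perfect_matching_index G k /\ k <= n) <->
  perfect_matching_cover G n.
Proof.
move=> Gcubic; split=> [[k [[covk _] le_kn]] | covn].
  exact: perfect_matching_cover_widen le_kn covk.
have ex_cov : exists k, perfect_matching_coverb G k.
  by exists n; apply/perfect_matching_coverP.
case: (ex_minnP ex_cov) => k /perfect_matching_coverP covk mink.
exists k; split; last by apply: mink; apply/perfect_matching_coverP.
by split=> // j /perfect_matching_coverP/mink.
Qed.

Theorem theorem5p2 (G : multigraph) (Gcubic : cubic G)
    (Gbridgeless : bridgeless G) :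
  (exists C : 'I_5 -> {set edge G},
     is_CDC C /\ exists i : 'I_5, two_factor (C i)) <->
  (exists k : nat, is_perfect_matching_index G k /\ k <= 4).
Proof.
rewrite perfect_matching_index_leP //; split; last exact: cover_CDC5_two_factor.
by move=> [C [cdcC [i facC]]]; apply: CDC5_two_factor_cover cdcC facC.
Qed.
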